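(* Let $b$ be a finite Blaschke product of degree $M$ and let $e_1,\ldots,e_M$ be an orthonormal basis of $\mathscr H(b)=\mathbf H_2\ominus b\mathbf H_2$. Then every $H\in\mathbf H_2^{p\times q}$ can be written in a unique way as $$H(z)=\sum_{j=1}^M e_j(z)H_j(b(z)),\qquad z\in\mathbb D,$$ where $H_1,\ldots,H_M\in\mathbf H_2^{p\times q}$, and moreover $$[H,H]=\sum_{j=1}^M[H_j,H_j].$$
   Context: $\mathbb D$ is the open unit disk and $\mathbf H_2$ is the Hardy space of $\mathbb D$: functions $f(z)=\sum_{n\ge 0}f_nz^n$ with $\|f\|_2^2=\sum_{n\ge0}|f_n|^2<\infty$, with the corresponding inner product. The superscript $*$ denotes complex conjugate (of a number) or conjugate transpose (of a matrix). A finite Blaschke product of degree $M\ge 1$ is a function $b(z)=c\prod_{\ell=1}^M\frac{z-a_\ell}{1-za_\ell^*}$ with $|c|=1$ and $a_1,\ldots,a_M\in\mathbb D$ (not necessarily distinct). The space $\mathscr H(b)=\mathbf H_2\ominus b\mathbf H_2$ is the orthogonal complement of $b\mathbf H_2$ in $\mathbf H_2$; it has dimension $M$. Let $p,q\ge1$ be integers. For a $\mathbb C^{p\times q}$-valued power series $f(z)=\sum_{n\ge0}f_nz^n$, one sets $[f,f]=\sum_{n=0}^\infty f_n^*f_n=\frac1{2\pi}\int_0^{2\pi}f(e^{it})^*f(e^{it})\,dt\in\mathbb C^{q\times q}$. The space $\mathbf H_2^{p\times q}$ consists of those $f$ for which $\mathrm{Tr}\,[f,f]<\infty$ (equivalently,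 all entries of $f$ are in $\mathbf H_2$). *)

(* Defs.v *)
From HB Require Import structures.
From mathcomp Require Import all_boot all_order all_algebra complex.
From mathcomp Require Import all_classical all_reals all_analysis.

Set Implicit Arguments.
Unset Strict Implicit.
Unset Printing Implicit Defensive.

Import Order.TTheory GRing.Theory Num.Theory numFieldNormedType.Exports.

Local Open Scope classical_set_scope.
Local Open Scope ring_scope.
Local Open Scope sesquilinear_scope.

(* The usual topology of the complex numbers: R[i] is normed by its modulus.
   It also provides the entrywise topology on matrices over R[i]. *)
HB.instance Definition _ (R : realType) := NormedModule.copy R[i] (R[i]^o).

Section Hardy.
Variable R : realType.
Local Notation C := R[i].

(* Scalar power series are represented by their Taylor coefficients, so f n is
   the coefficient of z ^+ n. As an element of H_2 is determined on the disk by
   its coefficients, equality of coefficient sequences is equality in H_2. *)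

Definition hardy : set (nat -> C) :=
  [set f : nat -> C | cvgn (series (fun n => `|f n| ^+ 2))].

Definition hardy_dot (f g : nat -> C) : C :=
  limn (series (fun n => f n * (g n)^*)).

(* Only meaningful when the power series converges at z; this is the case for
   f in H_2 and |z| < 1. *)
Definition ps_eval (f : nat -> C) (z : C) : C :=
  limn (series (fun n => f n * z ^+ n)).

(* Functions on the disk are total functions on C, of which only the values
   on the open disk are relevant. Note that |z| is an element of R[i], and that
   |z| < 1 in R[i] is the comparison of real numbers. *)
Definition finite_blaschke (M : nat) (b : C -> C) : Prop :=
  exists (c : C) (a : 'I_M -> C),
    [/\ `|c| = 1, forall l, `|a l| < 1
      & forall z, `|z| < 1 ->
          b z = c * \prod_(l < M) ((z - a l) / (1 - z * (a l)^*))].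

Definition mul_hardy (b : C -> C) : set (nat -> C) :=
  [set f : nat -> C | hardy f /\ exists2 g, hardy g &
     forall z, `|z| < 1 -> ps_eval f z = b z * ps_eval g z].

(* H(b) = H_2 (-) b H_2 *)
Definition model_space (b : C -> C) : set (nat -> C) :=
  [set f : nat -> C | hardy f /\ forall g, mul_hardy b g -> hardy_dot f g = 0].

Definition orthonormal_basis (M : nat) (V : set (nat -> C))
    (e : 'I_M -> nat -> C) : Prop :=
  [/\ forall j, V (e j),
      forall i j, hardy_dot (e i) (e j) = (i == j)%:R
    & forall f, V f -> exists k : 'I_M -> C,
        forall n, f n = \sum_(j < M) k j * e j n].

Section Matrix.
Variables p q : nat.
Implicit Type f : nat -> 'M[C]_(p, q).

Definition hardy_mx : set (nat -> 'M[C]_(p, q)) :=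
  [set f : nat -> 'M[C]_(p, q) | cvgn (series (fun n => \tr ((f n)^t* *m f n)))].

(* [f, f] *)
Definition bracket f : 'M[C]_q := limn (series (fun n => (f n)^t* *m f n)).

Definition ps_eval_mx f (z : C) : 'M[C]_(p, q) :=
  limn (series (fun n => z ^+ n *: f n)).

End Matrix.
End Hardy.

(* Main.v *)
(** Multiplication by b is an isometry V of H_2, and f - V V* f is orthogonal
    to b H_2, hence f = sum_j <f, e_j> e_j + V V* f. Iterating,
    <f, g> = sum_(m < N) sum_j <V*^m f, e_j> <V*^m g, e_j>^* + <V*^N f, V*^N g>.
    The remainder vanishes because V*^N tends strongly to 0: V* is triangular
    on the monomials with diagonal entry b(0)^*, of modulus < 1. So the
    contractions A_j f = (<f, V^m e_j>)_m satisfy Parseval's identity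
    sum_j A_j* A_j = 1, while A_i A_j* = delta_ij since the V^m e_j are
    orthonormal. Testing A_j* against reproducing kernels gives
    (A_j* d)(z) = e_j(z) d(b(z)), so that f = sum_j e_j (d_j o b) means
    f = sum_j A_j* d_j, which holds iff d_j = A_j f for all j. *)

Require Import Defs.
From HB Require Import structures.
From mathcomp Require Import all_boot all_order all_algebra complex.
From mathcomp Require Import all_classical all_reals all_analysis.
From mathcomp Require Import ring.

Set Implicit Arguments.
Unset Strict Implicit.
Unset Printing Implicit Defensive.

Import Order.TTheory GRing.Theory Num.Theory numFieldNormedType.Exports.

Local Open Scope ring_scope.

(** * Limits of complex sequences *)

Section HardySpace.
Local Open Scope classical_set_scope.
Variable R : realType.
Local Notation C := R[i].
Implicit Types (u v : nat -> C) (l : C).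

(** A nonnegative sequence equals its sequence of moduli, which tends to the modulus of [l]; by
    uniqueness of limits [l] is its own modulus. *)
Lemma cvgC_ge0 u l : u @ \oo --> l -> (forall n, 0 <= u n) -> 0 <= l.
Proof.
move=> ul u0.
have nl : (fun n => `|u n|) @ \oo --> (`|l| : C) by exact: cvg_norm.
have E : (fun n => `|u n|) = u by apply/funext => n; rewrite ger0_norm.
rewrite E in nl.
by rewrite (cvg_unique (@norm_hausdorff _ _) ul nl).
Qed.

Lemma cvgC_le u v l l' : u @ \oo --> l -> v @ \oo --> l' ->
  (forall n, u n <= v n) -> l <= l'.
Proof.
move=> ul vl uv; rewrite -subr_ge0.
by apply: (cvgC_ge0 (cvgB vl ul)) => n; rewrite fctE subr_ge0.
Qed.

Lemma cvg_real_complex (u : nat -> R) (l : R) : u @ \oo --> l ->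
  (fun n => (u n)%:C%C) @ \oo --> (l%:C%C : C).
Proof.
move=> ul; apply/cvgrPdist_lt => e e0.
(* A positive element of [R[i]] is real, so its real part serves as the tolerance in [R]. *)
have er : e = (complex.Re e)%:C%C by rewrite RRe_real// ger0_real// ltW.
have e0' : 0 < complex.Re e by move: e0; rewrite er ltcR.
have /cvgrPdist_lt/(_ _ e0') := ul.
apply: filterS => n; rewrite er -rmorphB.
by rewrite normc_def/= expr0n addr0 sqrtr_sqr ltcR.
Qed.

(** Nonnegative terms make the partial sums real, so monotone convergence applies to their real
    parts and is carried back to [R[i]]. *)
Lemma cvgC_bounded (u : nat -> C) (B : C) :
  (forall n, 0 <= u n) -> (forall n, series u n <= B) -> cvgn (series u).
Proof.
move=> u0 uB.
have sr n : series u n = (complex.Re (series u n))%:C%C.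
  by rewrite RRe_real// ger0_real// /series/= sumr_ge0.
have -> : series u = (fun n => (complex.Re (series u n))%:C%C) by apply/funext.
have cR : cvgn (fun n => complex.Re (series u n)).
  apply: nondecreasing_is_cvgn.
    apply/nondecreasing_seqP => n.
    have : series u n <= series u n.+1 by rewrite -subr_ge0 seriesSB.
    by rewrite lecE => /andP[].
  exists (complex.Re B) => _ [n _ <-].
  by have := uB n; rewrite lecE => /andP[].
apply: (@cvgP _ _ (limn (fun n => complex.Re (series u n)))%:C%C).
exact: cvg_real_complex.
Qed.

Lemma series_le_lim (u : nat -> C) : (forall n, 0 <= u n) ->
  cvgn (series u) -> forall n, series u n <= limn (series u).
Proof.
(* Shifting the index by [n] makes the comparison hold at every index, as [cvgC_le] requires. *)
move=> u0 cu n; apply: (@cvgC_le (fun=> series u n) (fun k => series u (k + n)%N)).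
- exact: cvg_cst.
- by rewrite cvg_shiftn.
- move=> k; rewrite /series/= addnC [leRHS](big_cat_nat (leq0n _) (leq_addr _ _))/=.
  by rewrite lerDl sumr_ge0.
Qed.

Lemma cvgC_squeeze0 (u v : nat -> C) : (forall n, `|u n| <= v n) ->
  v @ \oo --> (0 : C) -> u @ \oo --> (0 : C).
Proof.
move=> uv /cvgr0Pnorm_lt v0; apply/cvgr0Pnorm_lt => e e0.
apply: filterS (v0 _ e0) => n; apply: le_lt_trans.
by rewrite (le_trans (uv n))// real_ler_norm// ger0_real// (le_trans _ (uv n)).
Qed.

Lemma cvgC_nonincreasing (u : nat -> C) :
  (forall n, 0 <= u n) -> (forall n, u n.+1 <= u n) -> cvgn u.
Proof.
move=> u0 ud.
have ur n : u n = (complex.Re (u n))%:C%C by rewrite RRe_real// ger0_real.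
have -> : u = (fun n => (complex.Re (u n))%:C%C) by apply/funext.
apply: (@cvgP _ _ (limn (fun n => complex.Re (u n)))%:C%C).
apply: cvg_real_complex; apply: nonincreasing_is_cvgn.
  apply/nonincreasing_seqP => n.
  by have := ud n; rewrite lecE => /andP[].
exists 0 => _ [n _ <-].
by have := u0 n; rewrite lecE => /andP[].
Qed.

Lemma cvg_conjC u l : u @ \oo --> l -> (fun n => (u n)^*) @ \oo --> l^*.
Proof.
move=> /cvgrPdist_lt ul; apply/cvgrPdist_lt => e e0.
apply: filterS (ul _ e0) => n.
by rewrite -rmorphB norm_conjC.
Qed.

Lemma cvgC_sum (I : Type) (s : seq I) (F : I -> nat -> C) (l : I -> C) :
  (forall i, F i @ \oo --> l i) ->
  (fun N => \sum_(i <- s) F i N) @ \oo --> \sum_(i <- s) l i.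
Proof.
move=> Fl; elim: s => [|i s IH].
  rewrite big_nil (_ : (fun N => _) = fun=> 0); first exact: cvg_cst.
  by apply/funext => N; rewrite big_nil.
rewrite big_cons (_ : (fun N => _) = (fun N => F i N + \sum_(j <- s) F j N)).
  exact: (cvgD (Fl i) IH).
by apply/funext => N; rewrite big_cons.
Qed.

(** * The Hilbert space of square-summable sequences *)

Lemma hardy_bounded (u : nat -> C) (B : C) :
  (forall N, \sum_(n < N) `|u n| ^+ 2 <= B) -> hardy u.
Proof.
move=> uB; apply: (@cvgC_bounded _ B) => n; first by rewrite exprn_ge0.
by rewrite /series/= big_mkord.
Qed.

Lemma hardy_le (u : nat -> C) : hardy u -> forall N,
  \sum_(n < N) `|u n| ^+ 2 <= limn (series (fun n => `|u n| ^+ 2)).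
Proof.
move=> hu N; have := series_le_lim _ hu N.
by rewrite {1}/series/= big_mkord; apply => n; rewrite exprn_ge0.
Qed.

Lemma normD2_le (x y : C) : `|x + y| ^+ 2 <= 2 * `|x| ^+ 2 + 2 * `|y| ^+ 2.
Proof.
rewrite -subr_ge0 (_ : _ - _ = `|x - y| ^+ 2) ?exprn_ge0//.
by rewrite !normCK !rmorphD/= rmorphN; ring.
Qed.

(** The two squared moduli of sums recover the real and imaginary parts of the product. This reduces
    the convergence of inner products to that of series of squares. *)
Lemma polarization (x y : C) : x * y^* =
  2^-1 * (`|x + y| ^+ 2 + 'i * `|x + 'i * y| ^+ 2
          - (1 + 'i) * (`|x| ^+ 2 + `|y| ^+ 2)).
Proof.
rewrite !normCK !(rmorphD, rmorphM)/= conjCi.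
have i2 : 'i * 'i = -1 :> C by rewrite -expr2 sqrCi.
have n2 : 2 != 0 :> C by rewrite pnatr_eq0.
by field: i2.
Qed.

Definition hardy_pred : {pred (nat -> C)} := [pred f : nat -> C | `[< hardy f >]].

Lemma hardy_submod_closed : submod_closed hardy_pred.
Proof.
split.
  apply/asboolP/(@hardy_bounded _ 0) => N.
  by rewrite big1// => n _; rewrite normr0 expr0n.
move=> a f g /asboolP hf /asboolP hg; apply/asboolP.
apply: (@hardy_bounded _ (2 * (`|a| ^+ 2 * limn (series (fun n => `|f n| ^+ 2)))
  + 2 * limn (series (fun n => `|g n| ^+ 2)))) => N.
apply: (@le_trans _ _ (\sum_(n < N) (2 * (`|a| ^+ 2 * `|f n| ^+ 2) + 2 * `|g n| ^+ 2))).
  by apply: ler_sum => n _; rewrite -exprMn -normrM; exact: normD2_le.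
rewrite big_split/= -!mulr_sumr.
by rewrite lerD// ler_wpM2l ?hardy_le// ler_wpM2l ?exprn_ge0 ?hardy_le.
Qed.

HB.instance Definition _ := GRing.isSubmodClosed.Build _ _ hardy_pred
  hardy_submod_closed.

Record ell2 := Ell2 { ell2_val :> nat -> C; _ : ell2_val \in hardy_pred }.

HB.instance Definition _ := [isSub for ell2_val].

HB.instance Definition _ := [Choice of ell2 by <:].

HB.instance Definition _ := [SubChoice_isSubLmodule of ell2 by <:].

Definition toell2 (u : nat -> C) (hu : hardy u) : ell2 := Ell2 (asboolT hu).

Lemma toell2E u hu : @toell2 u hu = u :> (nat -> C).
Proof. by []. Qed.

Implicit Types f g h : ell2.

Lemma ell2P f : hardy f.
Proof. by case: f => u hu; exact: (asboolW hu). Qed.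

Lemma ell2_eq f g : (forall n, f n = g n) -> f = g.
Proof. by move=> fg; apply/val_inj/funext. Qed.

Lemma ell2D f g n : (f + g) n = f n + g n. Proof. by []. Qed.

Lemma ell2N f n : (- f) n = - f n. Proof. by []. Qed.

Lemma ell2Z a f n : (a *: f) n = a * f n. Proof. by []. Qed.

Lemma ell20 n : (0 : ell2) n = 0. Proof. by []. Qed.

Lemma ell2_sum I (r : seq I) P (F : I -> ell2) n :
  (\sum_(i <- r | P i) F i) n = \sum_(i <- r | P i) F i n.
Proof. by apply: (big_morph (fun f : ell2 => f n)). Qed.

Definition dot f g : C := hardy_dot f g.

Lemma dot_cvg f g : series (fun n => f n * (g n)^*) @ \oo --> dot f g.
Proof.
pose s (h : ell2) := series (fun n => `|h n| ^+ 2).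
have sc h : s h @ \oo --> limn (s h) by exact: ell2P.
suff : cvgn (series (fun n => f n * (g n)^*)) by [].
have -> : series (fun n => f n * (g n)^*) =
    (fun N => 2^-1 * (s (f + g) N + 'i * s (f + 'i *: g) N
                      - (1 + 'i) * (s f N + s g N))).
  apply/funext => N; rewrite /s /series/= !mulr_sumr -!big_split/=.
  rewrite !mulr_sumr -sumrB mulr_sumr; apply: eq_bigr => n _.
  exact: polarization.
apply: cvgP.
by apply: (cvgMl_tmp (cvgB (cvgD (sc _) (cvgMl_tmp (sc _)))
                           (cvgMl_tmp (cvgD (sc _) (sc _))))).
Qed.

Lemma dotP f g l : series (fun n => f n * (g n)^*) @ \oo --> l -> dot f g = l.
Proof. exact: (cvg_unique (@norm_hausdorff _ _) (@dot_cvg f g)). Qed.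

Lemma dotPl a f g h : dot (a *: f + g) h = a * dot f h + dot g h.
Proof.
apply: dotP.
have -> : series (fun n => (a *: f + g) n * (h n)^*) =
    (fun N => a * series (fun n => f n * (h n)^*) N
              + series (fun n => g n * (h n)^*) N).
  apply/funext => N; rewrite /series/= mulr_sumr -big_split/=.
  by apply: eq_bigr => n _; rewrite mulrA -mulrDl.
exact: (cvgD (cvgMl_tmp (@dot_cvg f h)) (@dot_cvg g h)).
Qed.

Lemma dotC f g : dot f g = (dot g f)^*.
Proof.
apply: dotP.
have -> : series (fun n => f n * (g n)^*) =
    (fun N => (series (fun n => g n * (f n)^*) N)^*).
  apply/funext => N; rewrite /series/= rmorph_sum/=.
  by apply: eq_bigr => n _; rewrite rmorphM/= conjCK mulrC.
exact: (cvg_conjC (@dot_cvg g f)).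
Qed.

Lemma dotDl f g h : dot (f + g) h = dot f h + dot g h.
Proof. by rewrite -{1}[f]scale1r dotPl mul1r. Qed.

Lemma dot0l f : dot 0 f = 0.
Proof. by apply: (addIr (dot 0 f)); rewrite -dotDl !add0r. Qed.

Lemma dotZl a f g : dot (a *: f) g = a * dot f g.
Proof. by rewrite -[a *: f]addr0 dotPl dot0l addr0. Qed.

Lemma dotNl f g : dot (- f) g = - dot f g.
Proof. by rewrite -scaleN1r dotZl mulN1r. Qed.

Lemma dotBl f g h : dot (f - g) h = dot f h - dot g h.
Proof. by rewrite dotDl dotNl. Qed.

Lemma dot_suml I (r : seq I) P (F : I -> ell2) f :
  dot (\sum_(i <- r | P i) F i) f = \sum_(i <- r | P i) dot (F i) f.
Proof.
by apply: (big_morph (fun g => dot g f)) => [g h|]; rewrite ?dotDl ?dot0l.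
Qed.

Lemma dotDr f g h : dot f (g + h) = dot f g + dot f h.
Proof. by rewrite dotC dotDl rmorphD/= -!dotC. Qed.

Lemma dotZr a f g : dot f (a *: g) = a^* * dot f g.
Proof. by rewrite dotC dotZl rmorphM/= -dotC. Qed.

Lemma dot0r f : dot f 0 = 0.
Proof. by rewrite dotC dot0l rmorph0. Qed.

Lemma dotNr f g : dot f (- g) = - dot f g.
Proof. by rewrite dotC dotNl rmorphN/= -dotC. Qed.

Lemma dotBr f g h : dot f (g - h) = dot f g - dot f h.
Proof. by rewrite dotDr dotNr. Qed.

Lemma dot_sumr I (r : seq I) P (F : I -> ell2) f :
  dot f (\sum_(i <- r | P i) F i) = \sum_(i <- r | P i) dot f (F i).
Proof.
by apply: (big_morph (fun g => dot f g)) => [g h|]; rewrite ?dotDr ?dot0r.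
Qed.

Definition nrm f : C := sqrtC (dot f f).

Lemma nrm2 f : nrm f ^+ 2 = dot f f.
Proof. by rewrite sqrtCK. Qed.

Lemma sum_le_dot f N : \sum_(n < N) `|f n| ^+ 2 <= dot f f.
Proof.
have -> : dot f f = limn (series (fun n => `|f n| ^+ 2)).
  by congr (limn (series _)); apply/funext => n; rewrite normCK.
exact: (hardy_le (@ell2P f) N).
Qed.

Lemma dot_ge0 f : 0 <= dot f f.
Proof. by apply: le_trans (sum_le_dot f 0); rewrite big_ord0. Qed.

Lemma dot_eq0 f : dot f f = 0 -> f = 0.
Proof.
move=> f0; apply: ell2_eq => n; apply/eqP; rewrite -normr_eq0 -sqrf_eq0.
rewrite eq_le exprn_ge0// andbT -f0.
apply: le_trans (sum_le_dot f n.+1).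
by rewrite big_ord_recr/= lerDr sumr_ge0// => i _; rewrite exprn_ge0.
Qed.

Lemma dot_inj f g : (forall h, dot f h = dot g h) -> f = g.
Proof.
move=> fg; apply/eqP; rewrite -subr_eq0; apply/eqP/dot_eq0.
by rewrite dotBl fg subrr.
Qed.

Lemma nrm_ge0 f : 0 <= nrm f.
Proof. by rewrite sqrtC_ge0 dot_ge0. Qed.

Lemma le_nrm f g : (nrm f <= nrm g) = (dot f f <= dot g g).
Proof. by rewrite ler_sqrtC ?nnegrE ?dot_ge0. Qed.

Lemma CauchySchwarz_ell2 f g : `|dot f g| ^+ 2 <= dot f f * dot g g.
Proof.
have [->|g0] := eqVneq g 0; first by rewrite !dot0r normr0 expr0n mulr0.
have gg : 0 < dot g g.
  by rewrite lt_def dot_ge0 andbT; apply: contra_neq g0 => /dot_eq0.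
have ggr : (dot g g)^* = dot g g by rewrite -dotC.
(* This vector is the component of [f] orthogonal to [g]; its squared norm times [dot g g] is the
   difference of the two sides. *)
have := dot_ge0 (f - (dot f g / dot g g) *: g).
rewrite dotBl !dotBr !dotZl !dotZr rmorphM/= fmorphV/= ggr (dotC g f).
rewrite -(pmulr_rge0 _ gg) normCK => h; rewrite -subr_ge0.
move: h; set x := (X in 0 <= X -> _); set y := (X in _ -> is_true (0 <= X)).
suff -> : x = y by [].
by rewrite /x /y; field; rewrite gt_eqF.
Qed.

Lemma dot_le f g : `|dot f g| <= nrm f * nrm g.
Proof.
rewrite -(@ler_pXn2r _ 2) ?nnegrE ?mulr_ge0 ?nrm_ge0//.
by rewrite exprMn !nrm2 CauchySchwarz_ell2.
Qed.

Lemma nrmD f g : nrm (f + g) <= nrm f + nrm g.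
Proof.
rewrite -(@ler_pXn2r _ 2) ?nnegrE ?addr_ge0 ?nrm_ge0//.
rewrite sqrrD !nrm2 dotDl !dotDr.
rewrite [leLHS](_ : _ = dot f f + (dot f g + dot g f) + dot g g); last by ring.
rewrite lerD2r lerD2l mulr2n.
apply: le_trans (lerD (dot_le f g) (dot_le f g)).
(* The two cross terms are conjugate, so their sum is real and at most its modulus. *)
rewrite (dotC g f) -[X in _ <= _ + X]norm_conjC.
apply: le_trans (ler_normD _ _); apply: real_ler_norm.
by rewrite CrealE rmorphD/= conjCK addrC.
Qed.

Lemma nrmZ a f : nrm (a *: f) = `|a| * nrm f.
Proof.
rewrite /nrm dotZl dotZr mulrA -normCK sqrtCM ?nnegrE ?exprn_ge0 ?dot_ge0//.
by rewrite sqrCK ?normr_ge0.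
Qed.

(** * Monomials and polynomial truncations *)

Lemma hardy_delta m : hardy (fun n => (n == m)%:R : C).
Proof.
apply: (@hardy_bounded _ 1) => N.
have [mN|mN] := ltnP m N.
  rewrite (bigD1 (Ordinal mN))//= eqxx normr1 expr1n big1 ?addr0// => i.
  by rewrite -val_eqE/= => /negPf ->; rewrite normr0 expr0n.
rewrite big1// => i _; rewrite (_ : _ == _ = false) ?normr0 ?expr0n//.
by rewrite ltn_eqF// (leq_trans _ mN).
Qed.

Definition delta m : ell2 := toell2 (@hardy_delta m).

Lemma deltaE m n : delta m n = (n == m)%:R.
Proof. by []. Qed.

(** The sequence [u] may be arbitrary: uniform bounds on these polynomials later serve to show that
    [u] lies in H_2. *)
Definition pol (u : nat -> C) N : ell2 := \sum_(n < N) u n *: delta n.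

Arguments delta : simpl never.

Arguments toell2 : simpl never.

Lemma polE u N n : pol u N n = if (n < N)%N then u n else 0.
Proof.
rewrite /pol ell2_sum; case: ltnP => nN.
  rewrite (bigD1 (Ordinal nN))// big1; last first.
    by move=> i; rewrite -val_eqE ell2Z deltaE eq_sym => /negPf ->; rewrite mulr0.
  by rewrite ell2Z deltaE eqxx mulr1 /= addr0.
rewrite big1// => i _; rewrite ell2Z deltaE gtn_eqF ?mulr0//.
exact: leq_trans nN.
Qed.

Lemma dot_deltar f (n : nat) : dot f (delta n) = f n.
Proof.
apply: dotP; apply: (@cvg_trans _ ((fun=> f n) @ \oo)); last exact: cvg_cst.
apply: near_eq_cvg; exists n.+1 => // N nN.
rewrite /series [RHS]big_mkord (bigD1 (Ordinal nN))// big1; last first.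
  by move=> i; rewrite -val_eqE deltaE => /negPf ->; rewrite conjC0 mulr0.
by rewrite deltaE eqxx conjC1 mulr1 /= addr0.
Qed.

Lemma dot_polr f u N : dot f (pol u N) = \sum_(n < N) f n * (u n)^*.
Proof.
by rewrite dot_sumr; apply: eq_bigr => n _; rewrite dotZr dot_deltar mulrC.
Qed.

Lemma dot_pol u N : dot (pol u N) (pol u N) = \sum_(n < N) `|u n| ^+ 2.
Proof.
by rewrite dot_polr; apply: eq_bigr => n _; rewrite polE ltn_ord normCK.
Qed.

(** Pythagoras: truncation is an orthogonal projection. *)
Lemma dot_trunc f N : dot (f - pol f N) (f - pol f N) = dot f f - dot (pol f N) (pol f N).
Proof.
have E : dot f (pol f N) = dot (pol f N) (pol f N).
  by rewrite dot_pol dot_polr; apply: eq_bigr => n _; rewrite normCK.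
have E' : dot (pol f N) f = dot (pol f N) (pol f N).
  by rewrite dotC E -dotC.
by rewrite dotBl !dotBr E E'; ring.
Qed.

(** Polynomials are dense: the squared distance is [dot f f] minus a partial sum of its defining
    series. *)
Lemma cvg_trunc f : (fun N => nrm (f - pol f N)) @ \oo --> (0 : C).
Proof.
apply/cvgr0Pnorm_lt => e e0.
have : (fun N => dot f f - dot (pol f N) (pol f N)) @ \oo --> (0 : C).
  rewrite -(subrr (dot f f)).
  apply: (cvgB (cvg_cst _)).
  rewrite (_ : (fun N => _) = series (fun n => f n * (f n)^*)).
    exact: dot_cvg.
  apply/funext => N; rewrite dot_pol /series/= big_mkord.
  by apply: eq_bigr => n _; rewrite normCK.
move=> /cvgr0Pnorm_lt/(_ _ (exprn_gt0 2 e0)).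
apply: filterS => N; rewrite -dot_trunc -nrm2 normrX.
by rewrite ltr_pXn2r// nnegrE ?ltW.
Qed.

Lemma le_of_sqr_le (x y : C) : 0 <= x -> 0 <= y -> x ^+ 2 <= y * x -> x <= y.
Proof.
move=> x0 y0 h; have [->//|xn0] := eqVneq x 0.
by rewrite -(@ler_pM2r _ x) -?expr2// lt_def xn0.
Qed.

Lemma hardy_pol (u : nat -> C) (B : C) : (forall N, nrm (pol u N) <= B) -> hardy u.
Proof.
move=> uB; apply: (@hardy_bounded _ (B ^+ 2)) => N.
have B0 : 0 <= B by apply: le_trans (uB 0%N); exact: nrm_ge0.
by rewrite -dot_pol -nrm2 ler_pXn2r// nnegrE nrm_ge0.
Qed.

Lemma linear_of (T : ell2 -> ell2) :
  (forall a f g, T (a *: f + g) = a *: T f + T g) ->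
  exists T' : {linear ell2 -> ell2}, forall f, T' f = T f.
Proof.
move=> TP.
pose T' : {linear ell2 -> ell2} := HB.pack T (GRing.isLinear.Build _ _ _ _ T TP).
by exists T'.
Qed.

(** * Adjoints *)

Definition contraction (T : ell2 -> ell2) := forall f, nrm (T f) <= nrm f.

Definition adjoint_pair (T T' : ell2 -> ell2) :=
  forall f g, dot (T' f) g = dot f (T g).

(** The [n]-th coefficient of the adjoint at [f] must be [dot f (T (delta n))]. Testing against
    truncations of this sequence bounds it in H_2; the adjoint identity is immediate on polynomials
    and extends by density. *)
Lemma adjoint_ex (T : {linear ell2 -> ell2}) : contraction T ->
  exists2 T' : {linear ell2 -> ell2}, contraction T' & adjoint_pair T T'.
Proof.
move=> Tc; pose u f n := dot f (T (delta n)).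
have dotT f v N : dot f (T (pol v N)) = \sum_(n < N) (v n)^* * u f n.
  rewrite /pol linear_sum dot_sumr; apply: eq_bigr => n _.
  by rewrite linearZ dotZr.
have hu f : hardy (u f).
  apply: (@hardy_pol _ (nrm f)) => N.
  have E : dot f (T (pol (u f) N)) = nrm (pol (u f) N) ^+ 2.
    by rewrite dotT nrm2 dot_pol; apply: eq_bigr => n _; rewrite normCK mulrC.
  have := dot_le f (T (pol (u f) N)).
  rewrite E ger0_norm ?exprn_ge0 ?nrm_ge0// => h.
  apply: le_of_sqr_le; rewrite ?nrm_ge0// (le_trans h)//.
  by rewrite ler_wpM2l ?nrm_ge0.
pose T1 f := toell2 (hu f).
have T1adj : adjoint_pair T T1.
  move=> f g; apply: dotP.
  have -> : series (fun n => T1 f n * (g n)^*) = (fun N => dot f (T (pol g N))).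
    apply/funext => N; rewrite dotT /series [LHS]big_mkord.
    by apply: eq_bigr => n _; rewrite mulrC.
  rewrite -[X in _ --> X]subr0.
  have -> : (fun N => dot f (T (pol g N))) =
      (fun N => dot f (T g) - dot f (T (g - pol g N))).
    by apply/funext => N; rewrite linearB dotBr; ring.
  apply: (cvgB (cvg_cst _)).
  apply: (@cvgC_squeeze0 _ (fun N => nrm f * nrm (g - pol g N))) => [N|].
    by apply: le_trans (dot_le _ _) _; rewrite ler_wpM2l ?nrm_ge0.
  by rewrite -[X in _ --> X](mulr0 (nrm f)); exact: (cvgMl_tmp (cvg_trunc g)).
have [|T' T'E] := @linear_of T1.
  move=> a f g; apply: dot_inj => h.
  by rewrite dotPl !T1adj dotPl.
exists T' => [f|f g]; last by rewrite T'E T1adj.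
have := dot_le f (T (T1 f)); rewrite T'E -T1adj ger0_norm ?dot_ge0// -nrm2 => h.
apply: le_of_sqr_le; rewrite ?nrm_ge0// (le_trans h)//.
by rewrite ler_wpM2l ?nrm_ge0.
Qed.

(** * Shift, reproducing kernels and evaluation *)

Lemma hardy_shift f : hardy (fun n => if n is m.+1 then f m else 0).
Proof.
apply: (@hardy_bounded _ (dot f f)) => -[|N].
  by rewrite big_ord0 dot_ge0.
by rewrite big_ord_recl/= normr0 expr0n add0r sum_le_dot.
Qed.

Definition shift f : ell2 := toell2 (@hardy_shift f).

Arguments shift : simpl never.

Lemma shiftE f n : shift f n = if n is m.+1 then f m else 0.
Proof. by []. Qed.

Lemma shift_is_linear : linear shift.
Proof.
move=> a f g; apply: ell2_eq => -[|n]; rewrite ell2D ell2Z !shiftE ?ell2D ?ell2Z//.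
by rewrite mulr0 addr0.
Qed.

HB.instance Definition _ := GRing.isLinear.Build _ _ _ _ shift shift_is_linear.

Lemma shift_delta n : shift (delta n) = delta n.+1.
Proof. by apply: ell2_eq => -[|m]; rewrite shiftE !deltaE. Qed.

(* The coefficients of u(z) / (1 - a z). *)
Fixpoint res_seq (a : C) (u : nat -> C) n : C :=
  if n is m.+1 then u n + a * res_seq a u m else u 0%N.

Lemma dot_shift f g : dot (shift f) (shift g) = dot f g.
Proof.
apply: dotP => /=; rewrite -(@cvg_shiftS).
apply: (@cvg_trans _ (series (fun n => f n * (g n)^*) @ \oo)); last exact: dot_cvg.
apply: near_eq_cvg; apply: nearW => N.
by rewrite /series/= big_nat_recl//= mul0r add0r.
Qed.

Lemma nrm_shift f : nrm (shift f) = nrm f.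
Proof. by rewrite /nrm dot_shift. Qed.

(** The bound B solves B = ||f|| + |a| B: each truncation is one of [f] plus [a] times the isometric
    shift of the preceding truncation. *)
Lemma hardy_res a f : `|a| < 1 ->
  forall N, nrm (pol (res_seq a f) N) <= nrm f / (1 - `|a|).
Proof.
move=> a1; have a1' : 0 < 1 - `|a| by rewrite subr_gt0.
elim=> [|N IH].
  rewrite /pol big_ord0 /nrm dot0l sqrtC0.
  by rewrite divr_ge0 ?nrm_ge0 ?ltW.
have -> : pol (res_seq a f) N.+1 = pol f N.+1 + a *: shift (pol (res_seq a f) N).
  apply: ell2_eq => n; rewrite ell2D ell2Z shiftE !polE.
  case: n => [|n]; rewrite ?polE ?mulr0 ?addr0// ltnS.
  by case: ifP => // _; rewrite mulr0 addr0.
apply: le_trans (nrmD _ _) _; rewrite nrmZ nrm_shift.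
have fN : nrm (pol f N.+1) <= nrm f by rewrite le_nrm dot_pol sum_le_dot.
apply: le_trans (lerD fN (ler_wpM2l (normr_ge0 a) IH)) _.
rewrite le_eqVlt; apply/orP; left; apply/eqP; field.
by rewrite gt_eqF.
Qed.

Lemma nrm_le_pol f B : (forall N, nrm (pol f N) <= B) -> nrm f <= B.
Proof.
move=> fB; have B0 : 0 <= B by apply: le_trans (fB 0%N); exact: nrm_ge0.
rewrite -(@ler_pXn2r _ 2) ?nnegrE ?nrm_ge0// nrm2.
apply: (@cvgC_le (series (fun n => f n * (f n)^*)) (fun=> B ^+ 2)).
- exact: dot_cvg.
- exact: cvg_cst.
move=> N; have -> : series (fun n => f n * (f n)^*) N = nrm (pol f N) ^+ 2.
  rewrite nrm2 dot_pol /series [LHS]big_mkord.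
  by apply: eq_bigr => n _; rewrite normCK.
by rewrite ler_pXn2r ?nnegrE ?nrm_ge0.
Qed.

(** Division of power series by 1 - a z; it supplies the denominators of the Blaschke factors. *)
Lemma resolvent_ex a : `|a| < 1 ->
  exists T : {linear ell2 -> ell2}, forall f, T f - a *: shift (T f) = f.
Proof.
move=> a1; pose T1 f := toell2 (hardy_pol (@hardy_res a f a1)).
have T10 f : T1 f 0%N = f 0%N by [].
have T1S f n : T1 f n.+1 = f n.+1 + a * T1 f n by [].
have T1E f : T1 f - a *: shift (T1 f) = f.
  apply: ell2_eq => -[|n]; rewrite ell2D ell2N ell2Z shiftE ?T10 ?T1S.
    by rewrite mulr0 subr0.
  by rewrite addrK.
have [|T TE] := @linear_of T1.
  move=> c f g; apply: ell2_eq; elim=> [|n IH].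
    by rewrite T10 2!ell2D 2!ell2Z !T10.
  by rewrite T1S IH 3!ell2D 3!ell2Z !T1S; ring.
by exists T => f; rewrite TE.
Qed.

(* The Szego kernel w |-> 1 / (1 - z^* w), with the junk value 0 off the disk. *)
Definition kernel (z : C) : ell2 :=
  if pselect (`|z^*| < 1) is left z1
  then toell2 (hardy_pol (@hardy_res z^* (delta 0%N) z1)) else 0.

Arguments kernel : simpl never.

Lemma nrm_kernel z : `|z| < 1 -> nrm (kernel z) <= (1 - `|z|)^-1.
Proof.
move=> z1; apply: nrm_le_pol => N; rewrite /kernel.
case: pselect => [z1'|]; last by rewrite norm_conjC.
rewrite toell2E (le_trans (hardy_res _ _ _))//.
by rewrite norm_conjC /nrm dot_deltar deltaE eqxx sqrtC1 mul1r.
Qed.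

(** The value at a point of the disk, by the reproducing property. As an inner product it is linear
    and bounded at once, and adjoints can be moved onto the kernel. *)
Definition ev f z : C := dot f (kernel z).

Lemma kernelE z n : `|z| < 1 -> kernel z n = z^* ^+ n.
Proof.
move=> z1; rewrite /kernel; case: pselect => [z1'|]; last by rewrite norm_conjC.
rewrite toell2E; elim: n => [|n IH]/=; first by rewrite expr0.
by rewrite add0r exprS -IH.
Qed.

Lemma evE f z : `|z| < 1 -> ps_eval f z = ev f z.
Proof.
move=> z1; rewrite /ps_eval /ev /dot /hardy_dot; congr (limn (series _)).
by apply/funext => n; rewrite kernelE// rmorphXn/= conjCK.
Qed.

(** The kernel equals [delta 0%N] plus z^* times its own shift, and [shift f] has no constant
    term. *)
Lemma ev_shift f z : `|z| < 1 -> ev (shift f) z = z * ev f z.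
Proof.
move=> z1; have -> : ev (shift f) z = dot (shift f) (delta 0%N + z^* *: shift (kernel z)).
  congr dot; apply: ell2_eq => -[|n]; rewrite ell2D ell2Z shiftE deltaE !kernelE//.
    by rewrite mulr0 addr0.
  by rewrite add0r exprS.
by rewrite dotDr dotZr dot_shift dot_deltar shiftE add0r conjCK.
Qed.

Lemma ev_delta0 z : `|z| < 1 -> ev (delta 0%N) z = 1.
Proof. by move=> z1; rewrite /ev dotC dot_deltar kernelE// expr0 conjC1. Qed.

Lemma ev0 f : ev f 0 = f 0%N.
Proof.
rewrite /ev; have -> : kernel 0 = delta 0%N; last by rewrite dot_deltar.
apply: ell2_eq => n; rewrite kernelE ?normr0// deltaE conjC0.
by case: n => [|n]; rewrite ?expr0// exprS mul0r.
Qed.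

Lemma ev_le f z : `|z| < 1 -> `|ev f z| <= nrm f / (1 - `|z|).
Proof.
move=> z1; apply: le_trans (dot_le _ _) _.
by rewrite ler_wpM2l ?nrm_ge0// nrm_kernel.
Qed.

Lemma ev_linear z a f g : ev (a *: f + g) z = a * ev f z + ev g z.
Proof. exact: dotPl. Qed.

(** Coefficients are peeled off one at a time through h = h_0 + z S h, with [S] the backward shift,
    adjoint to [shift]. Leaving out the point 0 lets the hypothesis pass to [S h] on division by
    z. *)
Lemma ev_eq0 f : (forall z, `|z| < 1 -> z != 0 -> ev f z = 0) -> f = 0.
Proof.
move=> f0.
have Zc : contraction shift by move=> g; rewrite nrm_shift.
have [S Sc Sadj] := adjoint_ex Zc.
have {}Sadj g h : dot (S g) h = dot g (shift h) by exact: Sadj.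
have SE h n : S h n = h n.+1 by rewrite -dot_deltar Sadj shift_delta dot_deltar.
have dec h : h = h 0%N *: delta 0%N + shift (S h).
  apply: ell2_eq => -[|n]; rewrite ell2D ell2Z deltaE shiftE ?SE.
    by rewrite mulr1 addr0.
  by rewrite mulr0 add0r.
pose vanish h := forall z, `|z| < 1 -> z != 0 -> ev h z = 0.
have step h : vanish h -> h 0%N = 0 /\ vanish (S h).
  move=> h0.
  have evh z : `|z| < 1 -> ev h z = h 0%N + z * ev (S h) z.
    by move=> z1; rewrite {1}(dec h) ev_linear ev_delta0// mulr1 ev_shift.
  (* Letting z -> 0 in h_0 = - z (S h)(z). *)
  have h00 : h 0%N = 0.
    (* [B] bounds the values of [S h] at points of modulus at most 1/2, by [ev_le]. *)
    pose B := nrm (S h) * 2.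
    have B0 : 0 <= B by rewrite mulr_ge0 ?nrm_ge0.
    apply/eqP; rewrite -normr_le0; apply: contraT => h0n.
    have hp : 0 < `|h 0%N|.
      by rewrite normr_gt0; apply: contraNneq h0n => ->; rewrite normr0.
    (* Chosen so that t <= 1/2 and t B < |h_0|, which contradicts |h_0| = t |(S h)(t)| <= t B. *)
    pose t := `|h 0%N| / (2 * (`|h 0%N| + B)).
    have hB : 0 < `|h 0%N| + B by rewrite ltr_wpDr.
    have t0 : 0 < t by rewrite divr_gt0// mulr_gt0.
    have th : t <= 2^-1.
      rewrite ler_pdivrMr ?mulr_gt0// mulrA mulVf ?pnatr_eq0// mul1r.
      by rewrite lerDl.
    have tn : `|t| = t by rewrite ger0_norm ?ltW.
    have t1 : `|t| < 1.
      by rewrite tn (le_lt_trans th)// invf_lt1 ?ltr1n// ltr0n.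
    have := evh t t1; rewrite h0// ?gt_eqF// => /esym/eqP.
    rewrite addr_eq0 => /eqP ht.
    have half : 2^-1 <= 1 - t.
      by rewrite lerBrDr [leRHS]splitr div1r lerD2l.
    have t1p : 0 < 1 - t by apply: lt_le_trans half; rewrite invr_gt0 ltr0n.
    have : `|h 0%N| <= t * B.
      rewrite ht normrN normrM tn ler_wpM2l ?(ltW t0)//.
      apply: le_trans (ev_le _ t1) _; rewrite /B tn ler_wpM2l ?nrm_ge0//.
      by rewrite -[leRHS]invrK lef_pV2 ?posrE ?invr_gt0 ?ltr0n.
    have : t * B < `|h 0%N|.
      rewrite /t mulrAC ltr_pdivrMr ?mulr_gt0// ltr_pM2l//.
      rewrite (_ : 2 * _ = B + (`|h 0%N| *+ 2 + B)); last by ring.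
      by rewrite ltrDl ltr_wpDr// mulr2n addr_gt0.
    by move=> /lt_geF ->.
  split=> // z z1 z0; have := evh z z1; rewrite h0// h00 add0r => /esym/eqP.
  by rewrite mulf_eq0 (negPf z0)/= => /eqP.
apply: ell2_eq => n; rewrite ell20.
have {f0} : vanish f by [].
elim: n f => [|n IH] f /step[f00 vS] //.
by rewrite -SE IH.
Qed.

Lemma ev_inj f g : (forall z, `|z| < 1 -> ev f z = ev g z) -> f = g.
Proof.
move=> fg; apply/eqP; rewrite -subr_eq0; apply/eqP/ev_eq0 => z z1 _.
by rewrite /ev dotBl [dot f _]fg// subrr.
Qed.

(** * Isometric multipliers and Blaschke products *)

(** The existence of such a [V] expresses that [b] is an inner function on the disk. *)
Definition multiplier (b : C -> C) (V : ell2 -> ell2) :=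
  (forall f g, dot (V f) (V g) = dot f g) /\
  (forall f z, `|z| < 1 -> ev (V f) z = b z * ev f z).

(* With Z the shift, V = (Z - a) (1 - a^* Z)^-1: since Z is an isometry, Z - a
   and 1 - a^* Z have the same Gram form. *)
Lemma multiplier_factor (a : C) : `|a| < 1 ->
  exists V : {linear ell2 -> ell2},
    multiplier (fun z => (z - a) / (1 - z * a^*)) V.
Proof.
move=> a1; have a1' : `|a^*| < 1 by rewrite norm_conjC.
have [T TE] := resolvent_ex a1'.
exists ((shift \o T) \- (a \*: T) : {linear ell2 -> ell2}).
split => [f g|f z z1] /=.
  rewrite -[X in _ = dot X _](TE f) -[X in _ = dot _ X](TE g).
  by rewrite !dotBl !dotBr !dotZl !dotZr dot_shift conjCK; ring.
have z0 : 1 - z * a^* != 0.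
  rewrite subr_eq0; apply: contraTneq (mulr_ilt1 (normr_ge0 z) (normr_ge0 _) z1 a1').
  by rewrite -normrM => <-; rewrite normr1 ltxx.
rewrite -[X in _ = _ * ev X _](TE f) /ev !dotBl !dotZl.
rewrite -/(ev _ _) -/(ev (T f) z) ev_shift//.
by field.
Qed.

(** Composing the operators multiplies their symbols. *)
Lemma multiplier_prod (s : seq C) : (forall a, a \in s -> `|a| < 1) ->
  exists V : {linear ell2 -> ell2},
    multiplier (fun z => \prod_(a <- s) ((z - a) / (1 - z * a^*))) V.
Proof.
elim: s => [_|a s IH sa].
  exists (idfun : {linear ell2 -> ell2}); split => // f z z1.
  by rewrite big_nil mul1r.
have [V1 [V1i V1e]] := multiplier_factor (sa a (mem_head _ _)).
have [|V2 [V2i V2e]] := IH; first by move=> x xs; apply: sa; rewrite in_cons xs orbT.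
exists (V1 \o V2 : {linear ell2 -> ell2}); split => [f g|f z z1] /=.
  by rewrite V1i V2i.
by rewrite V1e// V2e// big_cons mulrA.
Qed.

(** By |1 - z a^*|^2 - |z - a|^2 = (1 - |a|^2) (1 - |z|^2), whose positivity also keeps the
    denominator from vanishing. *)
Lemma factor_lt1 (a z : C) : `|a| < 1 -> `|z| < 1 ->
  `|(z - a) / (1 - z * a^*)| < 1.
Proof.
move=> a1 z1; have sq (x : C) : `|x| < 1 -> 0 < 1 - `|x| ^+ 2.
  by move=> x1; rewrite subr_gt0 expr_lt1.
have h : `|z - a| ^+ 2 < `|1 - z * a^*| ^+ 2.
  rewrite -subr_gt0 (_ : _ - _ = (1 - `|a| ^+ 2) * (1 - `|z| ^+ 2)).
    by rewrite mulr_gt0 ?sq.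
  by rewrite !normCK !rmorphB/= rmorphM/= conjCK rmorph1; ring.
rewrite normrM normfV ltr_pdivrMr ?mul1r.
  by move: h; rewrite ltr_pXn2r ?nnegrE.
rewrite normr_gt0; apply/eqP => E.
by move: h; rewrite E normr0 expr0n/= => /lt_geF; rewrite exprn_ge0.
Qed.

(** One factor gives strictness, and [0 < M] provides it; the others are at most 1 in modulus. *)
Lemma blaschke_lt1 M b z : (0 < M)%N -> @finite_blaschke R M b -> `|z| < 1 ->
  `|b z| < 1.
Proof.
case: M => // M _ [c [a [c1 a1 bE]]] z1.
rewrite bE// normrM c1 mul1r big_ord_recl normrM.
apply: (@le_lt_trans _ _ (`|(z - a ord0) / (1 - z * (a ord0)^*)| * 1)).
  rewrite ler_wpM2l// normr_prod prodr_ile1// => l _.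
  by rewrite normr_ge0/= ltW// factor_lt1.
by rewrite mulr1 factor_lt1.
Qed.

Lemma blaschke_multiplier M b : @finite_blaschke R M b ->
  exists V : {linear ell2 -> ell2}, multiplier b V.
Proof.
move=> [c [a [c1 a1 bE]]].
have [|V [Vi Ve]] := @multiplier_prod (map a (enum 'I_M)).
  by move=> _ /mapP[l _ ->].
exists (c \*: V : {linear ell2 -> ell2}); split => [f g|f z z1] /=.
  by rewrite dotZl dotZr mulrA -normCK c1 expr1n mul1r Vi.
rewrite /ev dotZl -/(ev _ _) Ve// mulrA bE//; congr (_ * _ * _).
by rewrite big_map big_enum.
Qed.

(** * Wold decomposition for an inner multiplier *)

Section InnerMultiplier.

Variables (b : C -> C) (V V' : {linear ell2 -> ell2}).

Hypothesis bV : multiplier b V.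

Hypothesis b_lt1 : forall z, `|z| < 1 -> `|b z| < 1.

Hypothesis V'c : contraction V'.

Hypothesis V'P : forall f g, dot (V' f) g = dot f (V g).

Let Vdot f g : dot (V f) (V g) = dot f g.
Proof. exact: bV.1. Qed.

Let Vev f z : `|z| < 1 -> ev (V f) z = b z * ev f z.
Proof. exact: bV.2. Qed.

(** Multiplications commute. Hence [V] is a lower triangular Toeplitz matrix on the monomials, and
    its diagonal entry can be read off in degree 0. *)
Lemma V_shift f : V (shift f) = shift (V f).
Proof.
by apply: ev_inj => z z1; rewrite Vev// !ev_shift// Vev// mulrCA.
Qed.

Lemma V_delta_diag n : V (delta n) n = b 0.
Proof.
elim: n => [|n IH]; last by rewrite -shift_delta V_shift shiftE.
by rewrite -ev0 Vev ?normr0// ev0 deltaE eqxx mulr1.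
Qed.

Lemma V_delta_lt n m : (n < m)%N -> V (delta m) n = 0.
Proof.
elim: m n => // m IH [|n] nm; rewrite -shift_delta V_shift shiftE//.
exact: IH.
Qed.

(** The matrix of [V'] is the conjugate transpose of the triangular matrix of [V], so no degree
    above [n] occurs. *)
Lemma V'_delta n : V' (delta n) = (b 0)^* *: delta n + pol (V' (delta n)) n.
Proof.
have V'E m : V' (delta n) m = (V (delta m) n)^*.
  by rewrite -dot_deltar V'P dotC dot_deltar.
apply: ell2_eq => m; rewrite ell2D ell2Z polE deltaE.
have [mn|nm|->] := ltngtP m n; first by rewrite mulr0 add0r.
  by rewrite V'E V_delta_lt// conjC0 mulr0 addr0.
by rewrite mulr1 addr0 V'E V_delta_diag.
Qed.

Lemma iter_V'P N a f g : iter N V' (a *: f + g) = a *: iter N V' f + iter N V' g.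
Proof. by elim: N => //= N ->; rewrite linearP. Qed.

Lemma nrm_iter_V' N f : nrm (iter N V' f) <= nrm f.
Proof. by elim: N => //= N; apply: le_trans (V'c _). Qed.

Let vanishing f := (fun N => nrm (iter N V' f)) @ \oo --> (0 : C).

Lemma vanishingP a f g : vanishing f -> vanishing g -> vanishing (a *: f + g).
Proof.
move=> vf vg.
apply: (@cvgC_squeeze0 _ (fun N => `|a| * nrm (iter N V' f) + nrm (iter N V' g))).
  move=> N; rewrite ger0_norm ?nrm_ge0// iter_V'P.
  by apply: le_trans (nrmD _ _) _; rewrite nrmZ.
rewrite -[X in _ --> X](addr0 0) -{1}(mulr0 `|a|).
exact: (cvgD (cvgMl_tmp vf) vg).
Qed.

Lemma vanishing0 : vanishing 0.
Proof.
apply: (@cvgC_squeeze0 _ (fun=> 0)); last exact: cvg_cst.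
move=> N; rewrite ger0_norm ?nrm_ge0// (le_trans (nrm_iter_V' N 0))//.
by rewrite /nrm dot0l sqrtC0.
Qed.

Lemma vanishing_pol (u : nat -> C) n :
  (forall m, (m < n)%N -> vanishing (delta m)) -> vanishing (pol u n).
Proof.
move=> vd; rewrite /pol; elim/big_ind: _ => [|f g vf vg|i _].
- exact: vanishing0.
- by rewrite -[f]scale1r; exact: vanishingP.
- rewrite -[_ *: _]addr0; apply: vanishingP; last exact: vanishing0.
  exact: vd.
Qed.

(* V' is triangular on the monomials, with diagonal entry (b 0)^*, and
   |b 0| < 1. *)
Lemma vanishing_delta n : vanishing (delta n).
Proof.
elim/ltn_ind: n => n IH.
have vw := vanishing_pol (V' (delta n)) IH.
pose u N := nrm (iter N V' (delta n)).
have uc : cvgn u.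
  by apply: cvgC_nonincreasing => N; rewrite /u ?nrm_ge0//=; exact: V'c.
set l := limn u in uc *.
have l0 : 0 <= l by apply: cvgC_ge0 uc _ => N; exact: nrm_ge0.
have uS : (fun N => u N.+1) @ \oo --> l by have := uc; rewrite -cvg_shiftS.
suff l00 : l = 0 by rewrite /vanishing -/u -l00.
(* Limit of u(N+1) <= |b(0)| u(N) + ||V'^N w||, where w is the part of degree below [n], whose
   iterates tend to 0 by induction. *)
have : l <= `|b 0| * l + 0.
  apply: (cvgC_le uS (cvgD (cvgMl_tmp uc) vw)) => N.
  rewrite /u iterSr {1}V'_delta iter_V'P.
  by apply: le_trans (nrmD _ _) _; rewrite nrmZ norm_conjC.
rewrite addr0 -subr_ge0 -{2}[l]mul1r -mulrBl => h.
apply/eqP; rewrite eq_le l0 andbT.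
move: h; rewrite -opprB mulNr oppr_ge0 pmulr_rle0//.
by rewrite subr_gt0 b_lt1// normr0.
Qed.

(** A polynomial approximates [f] within e/2, and the iterates of a contraction do not enlarge this
    error. *)
Lemma vanishing_all f : vanishing f.
Proof.
apply/cvgr0Pnorm_lt => e e0.
have e2 : 0 < e / 2 by rewrite divr_gt0.
have /cvgr0Pnorm_lt/(_ _ e2)[K _ /(_ K (leqnn K)) fK] := cvg_trunc f.
have : vanishing (pol f K) by apply: vanishing_pol => m _; exact: vanishing_delta.
move=> /cvgr0Pnorm_lt/(_ _ e2).
apply: filterS => N.
rewrite /= in fK; rewrite !ger0_norm ?nrm_ge0// in fK * => h.
rewrite -(subrK (pol f K) f) -[f - _]scale1r iter_V'P scale1r.
rewrite (le_lt_trans (nrmD _ _))// [e]splitr ltrD//.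
by rewrite (le_lt_trans (nrm_iter_V' _ _)).
Qed.

(** * Coordinates along an orthonormal basis of the model space *)

Variables (M : nat) (e : 'I_M -> ell2).

Hypothesis e_orth : forall j g, dot (e j) (V g) = 0.

Hypothesis e_on : forall i j, dot (e i) (e j) = (i == j)%:R.

Hypothesis e_span : forall f, (forall g, dot f (V g) = 0) ->
  exists k : 'I_M -> C, f = \sum_(j < M) k j *: e j.

Lemma wold_split f : f = \sum_(j < M) dot f (e j) *: e j + V (V' f).
Proof.
have [|k kE] := @e_span (f - V (V' f)).
  by move=> g; rewrite dotBl Vdot V'P subrr.
(* Pairing with [e j] identifies the coefficients, since [V (V' f)] is orthogonal to [e j]. *)
have kj j : dot f (e j) = k j.
  have -> : dot f (e j) = dot (f - V (V' f)) (e j).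
    by rewrite dotBl [dot (V _) _]dotC e_orth conjC0 subr0.
  rewrite kE dot_suml (bigD1 j)//= dotZl e_on eqxx mulr1 big1 ?addr0// => i ij.
  by rewrite dotZl e_on (negPf ij) mulr0.
rewrite -{1}(subrK (V (V' f)) f) kE; congr (_ + _).
by apply: eq_bigr => j _; rewrite kj.
Qed.

Lemma dot_wold f g :
  dot f g = \sum_(j < M) dot f (e j) * (dot g (e j))^* + dot (V' f) (V' g).
Proof.
rewrite {1}(wold_split f) dotDl dot_suml.
congr (_ + _).
  by apply: eq_bigr => j _; rewrite dotZl -dotC.
by rewrite dotC -V'P -dotC.
Qed.

Lemma dot_wold_iter N f g : dot f g =
  \sum_(m < N) \sum_(j < M) dot (iter m V' f) (e j) * (dot (iter m V' g) (e j))^*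
  + dot (iter N V' f) (iter N V' g).
Proof.
elim: N => [|N ->]; first by rewrite big_ord0 add0r.
by rewrite big_ord_recr /= -addrA -dot_wold.
Qed.

Let coef j f m := dot (iter m V' f) (e j).

(** Bessel's inequality: in [dot_wold_iter] with [g = f], the remainder and the terms of the other
    basis vectors are nonnegative. *)
Lemma nrm_pol_coef j f N : nrm (pol (coef j f) N) <= nrm f.
Proof.
rewrite le_nrm dot_pol (dot_wold_iter N f f) -[leLHS]addr0 lerD ?dot_ge0//.
apply: ler_sum => m _; rewrite (bigD1 j)//= -normCK lerDl sumr_ge0// => i _.
by rewrite -normCK exprn_ge0.
Qed.

(** [A f] is the power series to be composed with [b] in the [j]-th term of the expansion of [f];
    its coefficients are the coordinates of [f] along V^m e_j. *)
Lemma analysis_ex j : exists2 A : {linear ell2 -> ell2},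
  contraction A & forall f m, A f m = dot (iter m V' f) (e j).
Proof.
pose A1 f := toell2 (hardy_pol (nrm_pol_coef j f)).
have A1E f m : A1 f m = coef j f m by [].
have [|A AE] := @linear_of A1.
  move=> a f g; apply: ell2_eq => m.
  by rewrite ell2D ell2Z !A1E /coef iter_V'P dotPl.
exists A => [f|f m]; last by rewrite AE.
by rewrite AE; apply: nrm_le_pol => N; exact: nrm_pol_coef.
Qed.

Lemma dot_iter_V' m f g : dot (iter m V' f) g = dot f (iter m V g).
Proof. by elim: m f => // m IH f; rewrite iterSr IH V'P. Qed.

Lemma ev_iter_V m f z : `|z| < 1 -> ev (iter m V f) z = b z ^+ m * ev f z.
Proof.
move=> z1; elim: m => [|m IH] /=; first by rewrite expr0 mul1r.
by rewrite Vev// IH mulrA -exprS.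
Qed.

(** Isometry cancels common powers of [V]; what is left is [e_on], or a basis vector paired with a
    vector in the range of [V]. *)
Lemma dot_iter_V m k i j :
  dot (iter m V (e i)) (iter k V (e j)) = ((i == j) && (m == k))%:R.
Proof.
elim: m k => [|m IH] [|k] /=.
- by rewrite e_on andbT.
- by rewrite e_orth andbF.
- by rewrite dotC e_orth conjC0 andbF.
- by rewrite Vdot IH eqSS.
Qed.

(** * Parseval's identity; analysis and synthesis operators *)

Section Decomposition.

Variable A : 'I_M -> {linear ell2 -> ell2}.

Hypothesis AE : forall j f m, A j f m = dot (iter m V' f) (e j).

(** By [dot_wold_iter] the error of the partial sums is <V'^N f, V'^N g>, at most ||V'^N f|| ||g||,
    which tends to 0 by [vanishing_all]. *)
Lemma parseval f g : dot f g = \sum_(j < M) dot (A j f) (A j g).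
Proof.
apply/esym/eqP; rewrite eq_sym -subr_eq0; apply/eqP.
pose s N := \sum_(j < M) \sum_(m < N) A j f m * (A j g m)^*.
have sl : s @ \oo --> \sum_(j < M) dot (A j f) (A j g).
  rewrite (_ : s = fun N => \sum_(j < M) series (fun m => A j f m * (A j g m)^*) N).
    by apply: cvgC_sum => j; exact: dot_cvg.
  by apply/funext => N; apply: eq_bigr => j _; rewrite /series [RHS]big_mkord.
have d0 : (fun N => dot f g - s N) @ \oo --> (0 : C).
  apply: (@cvgC_squeeze0 _ (fun N => nrm (iter N V' f) * nrm g)) => [N|].
    have sE : s N = \sum_(m < N) \sum_(j < M)
        dot (iter m V' f) (e j) * (dot (iter m V' g) (e j))^*.
      rewrite /s exchange_big/=; apply: eq_bigr => m _.
      by apply: eq_bigr => j _; rewrite !AE.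
    rewrite (dot_wold_iter N f g) sE addrC addKr.
    by apply: le_trans (dot_le _ _) _; rewrite ler_wpM2l ?nrm_ge0 ?nrm_iter_V'.
  by rewrite -[X in _ --> X](mul0r (nrm g)); exact: (cvgMr_tmp (vanishing_all f)).
exact: (cvg_unique (@norm_hausdorff _ _) (cvgB (cvg_cst _) sl) d0).
Qed.

Variable B : 'I_M -> {linear ell2 -> ell2}.

Hypothesis BP : forall j f g, dot (B j f) g = dot f (A j g).

(* The adjoint B j sends d to the function e_j * (d o b), because A j maps the
   kernel at z to a multiple of the kernel at b z; in particular that function
   belongs to H_2. *)
Lemma ev_synthesis j d z : `|z| < 1 -> ev (B j d) z = ev (e j) z * ev d (b z).
Proof.
move=> z1; rewrite /ev BP.
have -> : A j (kernel z) = (ev (e j) z)^* *: kernel (b z).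
  apply: ell2_eq => m; rewrite ell2Z kernelE ?b_lt1// AE dot_iter_V' dotC.
  by rewrite -/(ev _ _) ev_iter_V// rmorphM rmorphXn mulrC.
by rewrite dotZr conjCK.
Qed.

(** By orthonormality [A j] maps V^m e_i to z^m if i = j and to 0 otherwise; adjunction then yields
    the coefficients. This is the source of uniqueness. *)
Lemma analysisK i j d : A i (B j d) = (i == j)%:R *: d.
Proof.
apply: ell2_eq => m; rewrite ell2Z AE dot_iter_V' BP.
have -> : A j (iter m V (e i)) = (i == j)%:R *: delta m.
  apply: ell2_eq => k; rewrite ell2Z deltaE AE dot_iter_V' dot_iter_V.
  by rewrite [k == m]eq_sym; case: (i == j); rewrite ?mul1r ?mul0r.
by rewrite dotZr dot_deltar conjC_nat.
Qed.

(** Parseval's identity read weakly, with each [A j] moved across as its adjoint [B j]. This is the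
    source of existence. *)
Lemma synthesisK f : \sum_(j < M) B j (A j f) = f.
Proof.
apply: dot_inj => g; rewrite dot_suml (parseval f g).
by apply: eq_bigr => j _; rewrite BP.
Qed.

(** Values on the disk force f = sum_j B_j d_j, and applying [A i] isolates [d i]. The converse is
    [synthesisK]. *)
Lemma expansionP f (d : 'I_M -> ell2) :
  (forall z, `|z| < 1 -> ev f z = \sum_(j < M) ev (e j) z * ev (d j) (b z)) <->
  (forall j, d j = A j f).
Proof.
have evB (x : 'I_M -> ell2) z : `|z| < 1 ->
    ev (\sum_(j < M) B j (x j)) z = \sum_(j < M) ev (e j) z * ev (x j) (b z).
  move=> z1; rewrite /ev dot_suml; apply: eq_bigr => j _.
  exact: ev_synthesis.
split=> [fd i|dA z z1]; last first.
  by rewrite -{1}(synthesisK f) evB//; apply: eq_bigr => j _; rewrite dA.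
have -> : f = \sum_(j < M) B j (d j).
  by apply: ev_inj => z z1; rewrite fd// evB.
rewrite linear_sum (bigD1 i)//= analysisK eqxx scale1r big1 ?addr0// => j ji.
by rewrite analysisK eq_sym (negPf ji) scale0r.
Qed.

End Decomposition.

End InnerMultiplier.

Lemma scalar_expansion M b (e : 'I_M -> nat -> C) :
  (0 < M)%N -> finite_blaschke M b -> orthonormal_basis (model_space b) e ->
  exists A : 'I_M -> ell2 -> ell2,
    (forall f g, dot f g = \sum_(j < M) dot (A j f) (A j g)) /\
    (forall f (d : 'I_M -> ell2),
      (forall z, `|z| < 1 ->
        ps_eval f z = \sum_(j < M) ps_eval (e j) z * ps_eval (d j) (b z)) <->
      (forall j, d j = A j f)).
Proof.
move=> M0 hb [eV eo es].
have b1 z : `|z| < 1 -> `|b z| < 1 by move=> z1; exact: (blaschke_lt1 M0 hb z1).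
have [V bV] := blaschke_multiplier hb; have [Vi Ve] := bV.
have Vc : contraction V by move=> f; rewrite /nrm Vi.
have [V' V'c V'P] := adjoint_ex Vc.
have he j : hardy (e j) by case: (eV j).
pose e' j := toell2 (he j).
have mulV g : mul_hardy b (V g).
  split; first exact: ell2P.
  by exists g; [exact: ell2P | move=> z z1; rewrite !evE// Ve].
have e_orth j g : dot (e' j) (V g) = 0.
  by have [_ h] := eV j; exact: h.
have e_on i j : dot (e' i) (e' j) = (i == j)%:R by exact: eo.
have e_span f : (forall g, dot f (V g) = 0) ->
    exists k : 'I_M -> C, f = \sum_(j < M) k j *: e' j.
  move=> fV; have [|k kE] := es f.
    split; first exact: ell2P.
    move=> g [hg [h hh gE]].
    (* An element of b H_2 has the same values on the disk as [V] of its cofactor, so it lies in the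
       range of [V]. *)
    have -> : g = V (toell2 hh); last exact: fV.
    rewrite -[g]/(toell2 hg : nat -> C); congr ell2_val.
    by apply: ev_inj => z z1; rewrite Ve// -!evE// gE.
  exists k; apply: ell2_eq => n; rewrite ell2_sum kE.
  by apply: eq_bigr => j _.
have [A Ac AE] : exists2 A : 'I_M -> {linear ell2 -> ell2},
    (forall j, contraction (A j)) &
    (forall j f m, A j f m = dot (iter m V' f) (e' j)).
  have h j := analysis_ex bV V'P e_orth e_on e_span j.
  have /choice[A hA] : forall j, exists A : {linear ell2 -> ell2},
      contraction A /\ forall f m, A f m = dot (iter m V' f) (e' j).
    by move=> j; have [A ? ?] := h j; exists A.
  by exists A => j; have [] := hA j.
have [B BP] : exists B : 'I_M -> {linear ell2 -> ell2},
    forall j f g, dot (B j f) g = dot f (A j g).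
  have /choice[B hB] : forall j, exists B : {linear ell2 -> ell2},
      adjoint_pair (A j) B.
    by move=> j; have [B _ ?] := adjoint_ex (Ac j); exists B.
  by exists B.
exists (fun j => A j); split=> [f g|f d].
  exact: (parseval bV b1 V'c V'P e_orth e_on e_span AE).
rewrite -(expansionP bV b1 V'c V'P e_orth e_on e_span AE BP).
split=> h z z1; have := h z z1.
  rewrite evE// => ->; apply: eq_bigr => j _.
  by rewrite -[e j]/(e' j : nat -> C) !evE// b1.
rewrite evE// => ->; apply: eq_bigr => j _.
by rewrite -[e j]/(e' j : nat -> C) !evE// b1.
Qed.

End HardySpace.

(** * Matrix-valued functions *)

Section Matrices.

Variables (R : realType) (p q : nat).

Local Notation C := R[i].

Local Open Scope sesquilinear_scope.

Local Open Scope classical_set_scope.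

Lemma cvg_mx (m n : nat) (u : nat -> 'M[C]_(m, n)) (L : 'M[C]_(m, n)) :
  (forall i j, (fun k => u k i j) @ \oo --> L i j) -> u @ \oo --> L.
Proof.
move=> uL; apply/cvg_ballP => e e0.
have h : \forall k \near \oo, forall i j, ball (L i j) e (u k i j).
  apply: filter_forall => i; apply: filter_forall => j.
  by have /cvg_ballP := uL i j; apply.
by apply: filterS h => k hk; split.
Qed.

Lemma limn_mx (m n : nat) (u : nat -> 'M[C]_(m, n)) (L : 'M[C]_(m, n)) :
  (forall i j, (fun k => u k i j) @ \oo --> L i j) -> limn u = L.
Proof. by move=> /cvg_mx; exact: (cvg_lim (@norm_hausdorff _ _)). Qed.

Definition entry (f : nat -> 'M[C]_(p, q)) r s n : C := f n r s.

Lemma gram_entry (A : 'M[C]_(p, q)) s t :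
  (A^t* *m A) s t = \sum_(r < p) A r t * (A r s)^*.
Proof. by rewrite mxE; apply: eq_bigr => r _; rewrite !mxE mulrC. Qed.

Lemma gram_trace (A : 'M[C]_(p, q)) :
  \tr (A^t* *m A) = \sum_(s < q) \sum_(r < p) `|A r s| ^+ 2.
Proof.
apply: eq_bigr => s _; rewrite gram_entry.
by apply: eq_bigr => r _; rewrite normCK.
Qed.

(** The conjugate falls on the row index of the Gram matrix, so entry (s, t) pairs column [t] with
    column [s], in this order. *)
Lemma bracketE (f : nat -> 'M[C]_(p, q)) (F : 'I_p -> 'I_q -> ell2 R) :
  (forall r s, F r s = entry f r s :> (nat -> C)) ->
  bracket f = \matrix_(s, t) \sum_(r < p) dot (F r t) (F r s).
Proof.
move=> FE; apply: limn_mx => s t; rewrite mxE.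
have -> : (fun N => series (fun n => (f n)^t* *m f n) N s t) =
    (fun N => \sum_(r < p) series (fun n => F r t n * (F r s n)^*) N).
  apply/funext => N; rewrite /series summxE exchange_big/=.
  apply: eq_bigr => n _; rewrite gram_entry.
  by apply: eq_bigr => r _; rewrite !FE.
by apply: cvgC_sum => r; exact: dot_cvg.
Qed.

(** The trace is the finite sum of the squared moduli of all entries, and it dominates each of
    them. *)
Lemma hardy_mxP (f : nat -> 'M[C]_(p, q)) :
  hardy_mx f <-> (forall r s, hardy (entry f r s)).
Proof.
have t0 n : 0 <= \tr ((f n)^t* *m f n).
  rewrite gram_trace; apply: sumr_ge0 => s _; apply: sumr_ge0 => r _.
  by rewrite exprn_ge0.
split=> [hf r s|hf].
  apply: (@hardy_bounded _ _ (limn (series (fun n => \tr ((f n)^t* *m f n))))) => N.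
  apply: le_trans (series_le_lim t0 hf N).
  rewrite /series [leRHS]big_mkord; apply: ler_sum => n _.
  rewrite gram_trace (bigD1 s)//= (bigD1 r)//= -addrA lerDl addr_ge0//.
    by apply: sumr_ge0 => i _; rewrite exprn_ge0.
  by apply: sumr_ge0 => i _; apply: sumr_ge0 => j _; rewrite exprn_ge0.
apply: (@cvgC_bounded _ _ (\sum_(s < q) \sum_(r < p)
  dot (toell2 (hf r s)) (toell2 (hf r s)))) => // N.
rewrite /series [leLHS]big_mkord.
under eq_bigr => n _ do rewrite gram_trace.
rewrite exchange_big/=; apply: ler_sum => s _; rewrite exchange_big/=.
by apply: ler_sum => r _; exact: (sum_le_dot (toell2 (hf r s))).
Qed.

Lemma ps_eval_mxE (f : nat -> 'M[C]_(p, q)) z : hardy_mx f -> `|z| < 1 ->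
  ps_eval_mx f z = \matrix_(r, s) ps_eval (entry f r s) z.
Proof.
move=> /hardy_mxP hf z1; apply: limn_mx => r s; rewrite mxE.
pose F := toell2 (hf r s).
rewrite -[entry f r s]/(F : nat -> C) evE//.
(* Each entry of the partial sums is a partial sum of the inner product of [F] with the kernel,
   which converges. *)
have -> : (fun N => series (fun n => z ^+ n *: f n) N r s) =
    series (fun n => F n * (kernel z n)^*).
  apply/funext => N; rewrite /series summxE; apply: eq_bigr => n _.
  by rewrite mxE kernelE// rmorphXn/= conjCK mulrC.
exact: dot_cvg.
Qed.

End Matrices.

Theorem theorem4p2 (R : realType) (M p q : nat)
    (hM : (0 < M)%N) (hp : (0 < p)%N) (hq : (0 < q)%N)
    (b : R[i] -> R[i]) (hb : finite_blaschke M b)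
    (e : 'I_M -> nat -> R[i]) (he : orthonormal_basis (model_space b) e)
    (H : nat -> 'M[R[i]]_(p, q)) (hH : hardy_mx H) :
  exists K : 'I_M -> nat -> 'M[R[i]]_(p, q),
    unique (fun L : 'I_M -> nat -> 'M[R[i]]_(p, q) =>
      (forall j, hardy_mx (L j)) /\
      (forall z : R[i], `|z| < 1 ->
         ps_eval_mx H z =
         \sum_(j < M) ps_eval (e j) z *: ps_eval_mx (L j) (b z))) K /\
    bracket H = \sum_(j < M) bracket (K j).
Proof.
have b1 z : `|z| < 1 -> `|b z| < 1 by move=> z1; exact: (blaschke_lt1 hM hb z1).
have [A [Adot AP]] := scalar_expansion hM hb he.
have hHe := (hardy_mxP H).1 hH.
pose F r s := toell2 (hHe r s).
(* The scalar decomposition is taken entry by entry. *)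
pose K j n := \matrix_(r, s) A j (F r s) n.
have KE j r s : entry (K j) r s = A j (F r s).
  by apply/funext => n; rewrite /entry mxE.
have hK j : hardy_mx (K j).
  by apply/hardy_mxP => r s; rewrite KE; exact: ell2P.
have expand (L : 'I_M -> nat -> 'M[R[i]]_(p, q)) (hL : forall j, hardy_mx (L j)) z :
    `|z| < 1 -> \sum_(j < M) ps_eval (e j) z *: ps_eval_mx (L j) (b z) =
    \matrix_(r, s) \sum_(j < M) ps_eval (e j) z * ps_eval (entry (L j) r s) (b z).
  move=> z1; apply/matrixP => r s; rewrite summxE mxE; apply: eq_bigr => j _.
  by rewrite mxE (ps_eval_mxE (hL j) (b1 _ z1)) mxE.
exists K; split; [split|].
- split=> // z z1; rewrite (expand K hK _ z1) (ps_eval_mxE hH z1).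
  apply/matrixP => r s; rewrite !mxE.
  have /(_ z z1) := (AP (F r s) (fun j => A j (F r s))).2 (fun=> erefl).
  by move=> ->; apply: eq_bigr => j _; rewrite KE.
- move=> L [hL LE]; apply/funext => j; apply/funext => n; apply/matrixP => r s.
  have hLe i := (hardy_mxP (L i)).1 (hL i).
  pose D i := toell2 (hLe i r s).
  (* Uniqueness is the forward direction of [AP], applied to one entry at a time. *)
  have DA : forall i, D i = A i (F r s).
    apply: (AP (F r s) D).1 => z z1.
    have := LE z z1; rewrite (expand L hL _ z1) (ps_eval_mxE hH z1) => /matrixP/(_ r s).
    by rewrite !mxE.
  by rewrite mxE -DA.
- rewrite (bracketE (F := F))//.
  apply/matrixP => s t; rewrite mxE summxE.
  under [RHS]eq_bigr => j _ do
    rewrite (bracketE (F := fun r s => A j (F r s))) ?mxE//.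
  (* For each row [r], Parseval's identity applies to the entries (r, t) and (r, s) of [H]. *)
  rewrite exchange_big/=; apply: eq_bigr => r _; exact: Adot.
Qed.
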